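(* Let $G$ be a path-bipartite graph of sets $A$ and $B$, let $a_1\in A$ and $b_1\in B$, let $A_1$ be the vertex set of the connected component of the induced graph $G[A]$ that contains $a_1$, and let $B_1$ be the vertex set of the connected component of the induced graph $G[B]$ that contains $b_1$. Write $C_1:=A_1\cup B_1$. Then the following statements are equivalent: (i) The pair $(a_1,b_1)$ belongs to $\mathcal{B}_{path}(G)$. (ii) The subgraph $G[C_1]$ induced in $G$ by the set $C_1$ is connected. (iii) The inclusion $A_1\times B_1\subseteq\mathcal{B}_{path}(G)$ holds.
   Context: Graphs are simple (no loops, no multiple edges), have a nonempty vertex set $V(G)$ and edge set $E(G)$, and may be infinite. $G[S]$ is the subgraph of $G$ induced by $S\subseteq V(G)$. A path is a finite graph $P$ whose (distinct) vertices can be numbered $u_0,\dots,u_k$, $k\ge 1$, so that $E(P)=\{\{u_0,u_1\},\dots,\{u_{k-1},u_k\}\}$; it joins $u_0$ and $u_k$. A graph is connected if any two distinct vertices are joined by a path in it. Let $A,B$ be nonempty disjoint sets. A path $P$ is a be-path of $A$ and $B$ if $V(P)\subseteq A\cup B$ and there is exactly one edge $\{a_0,b_0\}\in E(P)$ meeting both $A$ and $B$. A graph $G$ is a path-bipartite graph of $A$ and $B$ if $A,B\subseteq V(G)$ and $G$ is the union (of vertex sets and of edge sets) of a nonempty set of be-paths of $A$ and $B$. For such $G$, $\mathcal{B}_{path}(G)$ is the set of all $(a,b)\in A\times B$ for which there is a be-path of $A$ and $B$ that is a subgraph of $G$ and joins $a$ and $b$. *)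

(* Defs.v *)
From mathcomp Require Import all_boot boolp classical_sets.

Set Implicit Arguments.
Unset Strict Implicit.
Unset Printing Implicit Defensive.

Local Open Scope classical_set_scope.

(* Simple, possibly infinite graphs with vertices in a fixed type [T]; an edge
   is literally a two-element set of vertices. *)
Record graph (T : Type) := Graph {
  vertices : set T;
  edges : set (set T);
  vertices_nonempty : vertices !=set0;
  edgesP : forall e, edges e ->
    exists x y, [/\ vertices x, vertices y, x <> y & e = [set x; y]]
}.

Section Graphs.
Context {T : Type}.
Implicit Types (G H K P : graph T) (A B S : set T).

Definition subgraph H G :=
  vertices H `<=` vertices G /\ edges H `<=` edges G.

Lemma induced_edgesP G S e : [set e | edges G e /\ e `<=` S] e ->
  exists x y, [/\ S x, S y, x <> y & e = [set x; y]].
Proof.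
move=> [/edgesP [x [y [_ _ xy eE]]] eS]; exists x, y; split=> //.
- by apply: eS; rewrite eE; left.
- by apply: eS; rewrite eE; right.
Qed.

(* The inclusion [S `<=` vertices G] is not needed to build the graph; it is
   required because G[S] is defined only for such [S]. *)
Definition induced G S (S0 : S !=set0) (SG : S `<=` vertices G) : graph T :=
  Graph S0 (@induced_edgesP G S).

(* Only the values [u 0, ..., u k] matter. *)
Definition path_numbering P (k : nat) (u : nat -> T) :=
  [/\ 1 <= k,
      forall i j, i <= k -> j <= k -> u i = u j -> i = j,
      vertices P = [set u i | i in [set i | i <= k]]
    & edges P = [set [set u i; u i.+1] | i in [set i | i < k]]].

Definition is_path P := exists k u, path_numbering P k u.

Definition joins P (x y : T) :=
  exists k u, [/\ path_numbering P k u, u 0 = x & u k = y].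

Definition connected G :=
  forall x y, vertices G x -> vertices G y -> x <> y ->
  exists2 P, subgraph P G & joins P x y.

(* [H] is a maximal connected subgraph of [G]. *)
Definition component G H :=
  [/\ subgraph H G, connected H
    & forall K, subgraph K G -> connected K -> subgraph H K -> subgraph K H].

Definition be_path A B P :=
  [/\ is_path P,
      vertices P `<=` A `|` B
    & exists! e, [/\ edges P e, e `&` A !=set0 & e `&` B !=set0]].

Definition path_bipartite A B G :=
  [/\ A `<=` vertices G,
      B `<=` vertices G
    & exists Ps : set (graph T),
        [/\ Ps !=set0,
            Ps `<=` be_path A B,
            vertices G = \bigcup_(P in Ps) vertices P
          & edges G = \bigcup_(P in Ps) edges P]].

Definition B_path A B G : set (T * T) :=
  [set ab | [/\ A ab.1, B ab.2
    & exists P, [/\ be_path A B P, subgraph P G & joins P ab.1 ab.2]]].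

Lemma path_bipartite_subl A B G : path_bipartite A B G -> A `<=` vertices G.
Proof. by case. Qed.

Lemma path_bipartite_subr A B G : path_bipartite A B G -> B `<=` vertices G.
Proof. by case. Qed.

Lemma verticesU_nonempty H K : vertices H `|` vertices K !=set0.
Proof. by have [x Hx] := vertices_nonempty H; exists x; left. Qed.

Lemma componentsU_sub G A B (A0 : A !=set0) (B0 : B !=set0)
    (AG : A `<=` vertices G) (BG : B `<=` vertices G) H K :
  component (induced A0 AG) H -> component (induced B0 BG) K ->
  vertices H `|` vertices K `<=` vertices G.
Proof.
by move=> [[HA _] _ _] [[KB _] _ _] x [/HA /AG|/KB /BG].
Qed.

End Graphs.

(* Main.v *)
Require Import Defs.
From mathcomp Require Import all_boot boolp classical_sets.
From mathcomp Require Import zify.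
From Stdlib Require Import Relation_Operators Operators_Properties.

(** Both (i) and (ii) say that some edge of G joins [A_1] to [B_1]. A be-path
    from [a_1] to [b_1] leaves [A_1] along an edge which, by maximality of the
    component [A_1], ends in [B]; as this is the only edge of the path meeting
    both sides, the path then stays in [B], hence in [B_1]. Conversely, an edge
    between [a_0] in [A_1] and [b_0] in [B_1] extends by a path from [a] to [a_0]
    in [A_1] and a path from [b_0] to [b] in [B_1] to a be-path from [a] to [b],
    for all [a] in [A_1] and [b] in [B_1]. *)

Local Open Scope classical_set_scope.

Lemma set2_inj {T : Type} (x y z t : T) : [set x; y] = [set z; t] ->
  (x = z /\ y = t) \/ (x = t /\ y = z).
Proof.
move=> E.
have xE : [set z; t] x by rewrite -E; left.
have yE : [set z; t] y by rewrite -E; right.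
have zE : [set x; y] z by rewrite E; left.
have tE : [set x; y] t by rewrite E; right.
by case: xE => ?; case: yE => ?; case: zE => ?; case: tE => ?; subst; auto.
Qed.

(** * Walks along a binary relation *)

Section Walks.
Context {T : Type}.
Implicit Types (R : T -> T -> Prop) (u v : nat -> T) (S : set T).

(** Unlike in [path_numbering], [k = 0] is allowed, so a vertex is linked to itself. *)
Definition simple_walk R (k : nat) u :=
  (forall i j, i <= k -> j <= k -> u i = u j -> i = j) /\
  (forall i, i < k -> R (u i) (u i.+1)).

(** Induction prepends [x] to a simple walk; if [x] already occurs there at position [i], the walk
    is cut to start at [i] instead. *)
Lemma clos_simple_walk R x y : clos_refl_trans T R x y ->
  exists k u, [/\ simple_walk R k u, u 0 = x & u k = y].
Proof.
move=> xy.
elim: {xy}(clos_rt_rt1n _ _ _ _ xy) =>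
  [{}x|{}x z {}y Rxz _ [k [u [[uI uR] u0 uk]]]].
  by exists 0, (fun=> x); split=> //; split=> // i j; lia.
have [[i ik ux]|xu] := pselect (exists2 i, i <= k & u i = x).
  exists (k - i), (fun j => u (i + j)); split; rewrite ?addn0 ?subnKC //.
  split=> [j l jk lk /uI|j jk]; first by lia.
  by rewrite addnS; apply: uR; lia.
exists k.+1, (fun j => if j is j'.+1 then u j' else x); split=> //.
split=> [[|j] [|l] //= jk lk E|[|j] jk /=].
- by case: xu; exists l.
- by case: xu; exists j.
- by congr _.+1; apply: uI.
- by rewrite u0.
- exact: uR.
Qed.

Lemma walk_clos R k u i j : (forall l, l < k -> R (u l) (u l.+1)) ->
  i <= j -> j <= k -> clos_refl_trans T R (u i) (u j).
Proof.
move=> uR; elim: j => [|j IHj] ij jk.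
  by have -> : i = 0 by [lia]; exact: rt_refl.
move: ij; rewrite leq_eqVlt => /orP[/eqP ->|ij]; first exact: rt_refl.
by apply: (rt_trans _ _ _ (u j)); [apply: IHj; lia | apply: rt_step; exact: uR].
Qed.

Lemma clos_exit R S x y : clos_refl_trans T R x y -> S x -> ~ S y ->
  exists x' y', [/\ S x', ~ S y' & R x' y'].
Proof.
move=> xy.
elim: {xy}(clos_rt_rt1n _ _ _ _ xy) => // {}x z {}y Rxz _ IH Sx Sy.
by have [Sz|Sz] := pselect (S z); [exact: IH | exists x, z].
Qed.

(** In contrast to [clos_exit], the position of the exit in the walk is kept, as [be_path_tail]
    needs it. *)
Lemma walk_exit u S k : S (u 0) -> ~ S (u k) ->
  exists i, [/\ i < k, S (u i) & ~ S (u i.+1)].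
Proof.
move=> Su0; elim: k => // k IH Suk.
have [Sk|/IH[i [ik ? ?]]] := pselect (S (u k)); first by exists k.
by exists i; split=> //; exact: ltnW.
Qed.

Lemma simple_walk_cat R k l u v : simple_walk R k u -> simple_walk R l v ->
  R (u k) (v 0) -> (forall i j, i <= k -> j <= l -> u i <> v j) ->
  simple_walk R (k + l).+1 (fun i => if i <= k then u i else v (i - k.+1)).
Proof.
move=> [uI uR] [vI vR] uv uvD; split=> [i j il jl|i il].
  case: leqP => ik; case: leqP => jk E.
  - exact: uI.
  - by case: (uvD _ (j - k.+1) ik _ E); lia.
  - by case: (uvD _ (i - k.+1) jk _ (esym E)); lia.
  - by have := vI _ _ _ _ E; lia.
case: (ltngtP i k) => ik.
- exact: uR.
- by rewrite subSn //; apply: vR; lia.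
- by rewrite ik subnn.
Qed.

End Walks.

(** * Reachability, components and be-paths *)

Section GraphTheory.
Context {T : Type}.
Implicit Types (G H K P : graph T) (A B S : set T).

Definition adj G (x y : T) := edges G [set x; y].

(** Stands in for joining by paths: it composes freely, whereas concatenated paths may repeat
    vertices. *)
Definition reach G := clos_refl_trans T (adj G).

Lemma adj_sym G x y : adj G x y -> adj G y x.
Proof. by rewrite /adj setUC. Qed.

Lemma adj_vertices G x y : adj G x y -> [/\ vertices G x, vertices G y & x <> y].
Proof.
move=> /edgesP[z [t [Gz Gt zt E]]].
by case: (set2_inj _ _ _ _ E) => -[-> ->]; split=> //; exact: nesym.
Qed.

Lemma reach_sym G x y : reach G x y -> reach G y x.
Proof.
elim=> [{}x {}y /adj_sym|{}x|{}x {}y z _ yx _ zy].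
- exact: rt_step.
- exact: rt_refl.
- exact: rt_trans zy yx.
Qed.

Lemma reach_sub G H x y : edges H `<=` edges G -> reach H x y -> reach G x y.
Proof.
move=> HG; elim=> [{}x {}y /HG|{}x|{}x {}y z _ xy _ yz].
- exact: rt_step.
- exact: rt_refl.
- exact: rt_trans xy yz.
Qed.

Lemma simple_walk_path H k u : 0 < k -> simple_walk (adj H) k u ->
  exists2 P, subgraph P H & path_numbering P k u.
Proof.
move=> k0 [uI uR].
have V0 : [set u i | i in [set i | i <= k]] !=set0 by exists (u 0), 0.
have EP e : [set [set u i; u i.+1] | i in [set i | i < k]] e ->
    exists x y, [/\ [set u i | i in [set i | i <= k]] x,
      [set u i | i in [set i | i <= k]] y, x <> y & e = [set x; y]].
  move=> [i /= ik <-]; exists (u i), (u i.+1); split=> //.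
  - by exists i => //=; exact: ltnW.
  - by exists i.+1.
  - by move/uI; lia.
exists (Graph V0 EP); last by split.
split=> [_ [i /= ik <-]|_ [i /= ik <-]]; last exact: uR.
(* Each vertex is an end of an edge of [H]; for [u 0] this takes the first edge, which exists by
   [0 < k]. *)
case: i ik => [|i] ik; first by have [] := adj_vertices _ _ _ (uR _ k0).
by have [] := adj_vertices _ _ _ (uR _ ik).
Qed.

Lemma connectedP H : connected H <->
  forall x y, vertices H x -> vertices H y -> reach H x y.
Proof.
split=> [HC x y Hx Hy|HR x y Hx Hy xy].
  have [->|xy] := pselect (x = y); first exact: rt_refl.
  have [P [_ PH] [k [u [[_ _ _ PE] <- <-]]]] := HC x y Hx Hy xy.
  apply: (walk_clos _ k) => // i ik.
  by apply: PH; rewrite PE; exists i.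
have [k [u [uW u0 uk]]] := clos_simple_walk _ _ _ (HR x y Hx Hy).
(* A path has at least one edge; [x <> y] excludes length 0. *)
have k0 : 0 < k by case: k uk {uW} => // uk; case: xy; rewrite -u0.
have [P PH Pu] := simple_walk_path _ _ _ k0 uW.
by exists P => //; exists k, u.
Qed.

(* The component is enlarged by [y] to the subgraph of [H] induced by
   [y |` vertices K]. *)
Lemma component_closed H K x y :
  component H K -> vertices K x -> adj H x y -> vertices K y.
Proof.
move=> [[KHV KHE] /connectedP KC Kmax] Kx Hxy.
have [Hx Hy _] := adj_vertices _ _ _ Hxy.
pose S := y |` vertices K.
have S0 : S !=set0 by exists y; left.
have SH : S `<=` vertices H by move=> z [->//|/KHV].
have KS : subgraph K (induced S0 SH).
  split=> [z|e Ke]; first by right.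
  split; first exact: KHE.
  by have [z [t [Kz Kt _ ->]]] := edgesP Ke => _ [->|->]; right.
suff SC : connected (induced S0 SH).
  have SsubH : subgraph (induced S0 SH) H by split=> // e [].
  have [SK _] := Kmax _ SsubH SC KS.
  by apply: SK; left.
have xS z : S z -> reach (induced S0 SH) x z.
  move=> [->|Kz]; last by apply: reach_sub (KC _ _ Kx Kz); case: KS.
  by apply: rt_step; split=> // _ [->|->]; [right | left].
apply/connectedP => z t Sz St.
exact: rt_trans (reach_sym _ _ _ (xS z Sz)) (xS t St).
Qed.

(** The linking edge from [u k] to [v 0] is the only crossing one: edges before it have both ends in
    [A], edges after it both ends in [B]. *)
Lemma be_pathI A B H P k l u v : A `&` B = set0 ->
  (forall i, i <= k -> A (u i)) -> (forall i, i <= l -> B (v i)) ->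
  path_numbering P (k + l).+1 (fun i => if i <= k then u i else v (i - k.+1)) ->
  be_path A B P.
Proof.
move=> AB uA vB Pn; have [_ _ PV PE] := Pn.
have AnB x : A x -> B x -> False by move=> Ax Bx; have : set0 x by rewrite -AB.
split; first by exists (k + l).+1; eexists; exact: Pn.
  rewrite PV => _ [i /= il <-]; case: leqP => ik; [left; exact: uA | right].
  by apply: vB; lia.
exists [set u k; v 0]; split.
  split; last 2 first.
  - by exists (u k); split; [left | exact: uA].
  - by exists (v 0); split; [right | exact: vB].
  by rewrite PE; exists k => /=; rewrite ?leqnn ?ltnn ?subnn //; lia.
move=> e [+ [x [xe Ax]] [y [ye By]]].
rewrite PE => -[i /= il eE]; subst e; move: xe ye.
case: (ltngtP i k) => ik.
- by move=> _ [] /= E; case: (AnB y _ By); rewrite E; apply: uA; lia.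
- by move=> [] /= E _; case: (AnB x Ax); rewrite E; apply: vB; lia.
- by rewrite ik subnn.
Qed.

(** A first return to [A] at [u j.+1] would be along a second crossing edge. By uniqueness it equals
    the edge at [i], so [u i] is [u j] or [u j.+1], against injectivity since [i < j]. *)
Lemma be_path_tail A B P k u i : A `&` B = set0 -> be_path A B P ->
  path_numbering P k u -> i < k -> A (u i) -> B (u i.+1) ->
  forall j, i < j -> j <= k -> B (u j).
Proof.
move=> AB [_ PAB [e [_ e_uniq]]] [_ uI PV PE] ik Aui Bui.
elim=> // j IH; rewrite ltnS leq_eqVlt => /orP[/eqP <- //|ij] jk.
have Bj : B (u j) by apply: IH => //; exact: ltnW.
have : (A `|` B) (u j.+1) by apply: PAB; rewrite PV; exists j.+1.
move=> [Aj|//].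
have E1 : e = [set u i; u i.+1].
  apply: e_uniq; split; first by rewrite PE; exists i.
  - by exists (u i); split=> //; left.
  - by exists (u i.+1); split=> //; right.
have E2 : e = [set u j; u j.+1].
  apply: e_uniq; split; first by rewrite PE; exists j.
  - by exists (u j.+1); split=> //; right.
  - by exists (u j); split=> //; left.
have : [set u j; u j.+1] (u i) by rewrite -E2 E1; left.
by move=> [/uI|/uI]; lia.
Qed.

End GraphTheory.

Theorem theorem2p3 (T : Type) (A B : set T)
    (A0 : A !=set0) (B0 : B !=set0) (AB : A `&` B = set0)
    (G : graph T) (GAB : path_bipartite A B G)
    (a1 b1 : T) (Aa1 : A a1) (Bb1 : B b1)
    (KA KB : graph T)
    (compA : component (induced A0 (path_bipartite_subl GAB)) KA)
    (KAa1 : vertices KA a1)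
    (compB : component (induced B0 (path_bipartite_subr GAB)) KB)
    (KBb1 : vertices KB b1) :
  [<-> B_path A B G (a1, b1);
       connected (induced (verticesU_nonempty KA KB)
                          (componentsU_sub compA compB));
       vertices KA `*` vertices KB `<=` B_path A B G].
Proof.
have AnB x : A x -> B x -> False by move=> Ax Bx; have : set0 x by rewrite -AB.
have [[KAA KAE] /connectedP KAC _] := compA.
have [[KBB KBE] /connectedP KBC _] := compB.
have KA_closed x y : vertices KA x -> A y -> adj G x y -> vertices KA y.
  move=> KAx Ay Gxy; apply: (component_closed _ _ _ _ compA KAx).
  by split=> // _ [->|->] //; exact: KAA.
have KB_closed x y : vertices KB x -> B y -> adj G x y -> vertices KB y.
  move=> KBx By Gxy; apply: (component_closed _ _ _ _ compB KBx).
  by split=> // _ [->|->] //; exact: KBB.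
tfae.
- move=> [_ _ [P [Pbe [_ PG] [k [u [Pu u0 uk]]]]]].
  have [_ PAB _] := Pbe; have [_ uI PV PE] := Pu.
  have uG i : i < k -> adj G (u i) (u i.+1).
    by move=> ik; apply: PG; rewrite PE; exists i.
  have [i [ik KAi nKAi]] : exists i,
      [/\ i < k, vertices KA (u i) & ~ vertices KA (u i.+1)].
    by apply: walk_exit; rewrite ?u0 ?uk //= => /KAA /AnB; exact.
  have Bi : B (u i.+1).
    have : (A `|` B) (u i.+1) by apply: PAB; rewrite PV; exists i.+1.
    by move=> [Ai|//]; case: nKAi; apply: KA_closed (uG i ik).
  have Btail := be_path_tail _ _ _ _ _ _ AB Pbe Pu ik (KAA _ KAi) Bi.
  (* Backward induction along the path from [u k = b1], with [d] the distance to the end. *)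
  have KBtail d : i < k - d -> vertices KB (u (k - d)).
    elim: d => [|d IH] id; first by rewrite subn0 uk.
    have kd : (k - d.+1).+1 = k - d by lia.
    have KBd : vertices KB (u (k - d)) by apply: IH; lia.
    apply: (KB_closed _ _ KBd); first by apply: Btail; lia.
    by apply: adj_sym; rewrite -kd; apply: uG; lia.
  have KBi : vertices KB (u i.+1).
    have -> : i.+1 = k - (k - i.+1) by lia.
    by apply: KBtail; lia.
  set C := induced _ _.
  have KAsub : edges KA `<=` edges C.
    move=> e KAe; split; first by case: (KAE _ KAe).
    by have [z [t [Kz Kt _ ->]]] := edgesP KAe => _ [->|->]; left.
  have KBsub : edges KB `<=` edges C.
    move=> e KBe; split; first by case: (KBE _ KBe).
    by have [z [t [Kz Kt _ ->]]] := edgesP KBe => _ [->|->]; right.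
  (* From [u i], [KA] is reached inside itself, and [KB] through the crossing edge to [u i.+1]. *)
  have uC x : vertices C x -> reach C (u i) x.
    move=> [KAx|KBx]; first exact: reach_sub KAsub (KAC _ _ KAi KAx).
    apply: rt_trans (reach_sub _ _ _ _ KBsub (KBC _ _ KBi KBx)).
    by apply: rt_step; split; [exact: uG | move=> _ [->|->]; [left | right]].
  apply/connectedP => x y Cx Cy.
  exact: rt_trans (reach_sym _ _ _ (uC x Cx)) (uC y Cy).
- move=> /connectedP CC [a b] [/= KAa KBb].
  have nKAb : ~ vertices KA b by move=> /KAA /AnB; apply; exact: KBB.
  (* A walk from [a] to [b] in the induced graph leaves [KA] by some edge; its new end, a vertex of
     that graph outside [KA], lies in [KB]. *)
  have [a0 [b0 [KAa0 nKAb0 Cab]]] :=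
    clos_exit _ _ _ _ (CC a b (or_introl KAa) (or_intror KBb)) KAa nKAb.
  have KBb0 : vertices KB b0 by have [_ [] ] := adj_vertices _ _ _ Cab.
  have KAG : edges KA `<=` edges G by move=> e /KAE[].
  have KBG : edges KB `<=` edges G by move=> e /KBE[].
  have [k [u [[uI uR] u0 uk]]] := clos_simple_walk _ _ _ (KAC _ _ KAa KAa0).
  have [l [v [[vI vR] v0 vl]]] := clos_simple_walk _ _ _ (KBC _ _ KBb0 KBb).
  (* Index 0 is treated apart because the walk may have no edge, namely when [a = a0]. *)
  have uA i : i <= k -> A (u i).
    case: i => [_|i /uR Kw]; first by rewrite u0; exact: KAA.
    by have [_ /KAA] := adj_vertices _ _ _ Kw.
  have vB i : i <= l -> B (v i).
    case: i => [_|i /vR Kw]; first by rewrite v0; exact: KBB.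
    by have [_ /KBB] := adj_vertices _ _ _ Kw.
  have uW : simple_walk (adj G) k u by split=> // i /uR /KAG.
  have vW : simple_walk (adj G) l v by split=> // i /vR /KBG.
  have uvG : adj G (u k) (v 0) by rewrite uk v0; case: Cab.
  have wW := simple_walk_cat _ _ _ _ _ uW vW uvG
    (fun i j ik jl E => AnB _ (uA i ik) (eq_ind_r B (vB j jl) E)).
  have [P PG Pw] := simple_walk_path _ _ _ (ltn0Sn _) wW.
  split=> /=; [exact: KAA | exact: KBB | exists P; split=> //].
    exact: be_pathI AB uA vB Pw.
  exists (k + l).+1; eexists; split; [exact: Pw | by [] |].
  (* The last index exceeds [k], so the concatenation takes the value [v l = b] there. *)
  by rewrite /= ltnNge leq_addr /= subSS addKn.
- by move=> /(_ (a1, b1)); apply; split.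
Qed.
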